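(* Let $E\subset\mathbb{R}$ be a compact set that is regular (for potential theory) and is a Parreau--Widom set. For each $n\ge 1$ let $T_n$ be the $n$th Chebyshev polynomial of $E$. Then for all $n\ge 1$, $$\|T_n\|_E\le 2\exp(PW(E))\,C(E)^n .$$
   Context: For a compact set $E\subset\mathbb{C}$ with infinitely many points, $\|f\|_E=\sup_{z\in E}|f(z)|$, and the $n$th Chebyshev polynomial $T_n$ of $E$ is the (unique) monic polynomial of degree $n$ minimizing $\|\cdot\|_E$ among monic polynomials of degree $n$. Potential theory: the Robin constant is $R(E)=\inf\{\iint\log|x-y|^{-1}d\mu(x)d\mu(y)\}$ over probability measures $\mu$ supported in $E$, and $C(E)=\exp(-R(E))$ is the logarithmic capacity. If $C(E)>0$ there is a unique minimizing measure $\rho_E$ (equilibrium measure), and the Green's function of $E$ is $G_E(z)=R(E)-\int_E\log|x-z|^{-1}d\rho_E(x)$. The set $E$ is called regular if $G_E$ is zero on $E$ and continuous on all of $\mathbb{C}$. With $\partial=\frac12(\partial_x-i\partial_y)$, let $\mathcal{C}$ be the set of critical points of $G_E$ in $\mathbb{C}\setminus E$, i.e. points $w$ with $\partial G_E(w)=0$. $E$ is called a Parreau--Widom set if $PW(E):=\sum_{w\in\mathcal{C}}G_E(w)<\infty$. *)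

(* Defs.v *)
From HB Require Import structures.
From mathcomp Require Import all_boot all_order all_algebra complex.
From mathcomp Require Import all_classical all_reals all_analysis.

Set Implicit Arguments.
Unset Strict Implicit.
Unset Printing Implicit Defensive.

Import Order.TTheory GRing.Theory Num.Theory.
Import numFieldNormedType.Exports.

Local Open Scope classical_set_scope.
Local Open Scope complex_scope.
Local Open Scope ring_scope.
Local Open Scope ereal_scope.

(* [R[i]^o] is [R[i]] seen as a normed module over itself; it carries the
   usual topology of the complex plane. *)
Notation Cplx R := (R[i]^o)%type.

(* The complex plane with its Borel sigma-algebra. *)
Notation BorelC R := (g_sigma_algebraType (@open (Cplx R))).

(* [normc] is the modulus with values in [R]; [`|z|] has values in [R[i]]. *)
Notation modc := (@ComplexField.Normc.normc _).

Definition supnorm (R : realType) (E : set (Cplx R)) (f : Cplx R -> Cplx R) :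
    \bar R :=
  ereal_sup [set (modc (f z))%:E | z in E].

Definition is_chebyshev (R : realType) (E : set (Cplx R)) (n : nat)
    (T : {poly R[i]}) : Prop :=
  [/\ T \is monic, size T = n.+1 &
    forall P : {poly R[i]}, P \is monic -> size P = n.+1 ->
      supnorm E (horner T) <= supnorm E (horner P)].

(* log |x - y|^-1. As [lne 0 = -oo], it is [+oo] on the diagonal. *)
Definition log_kernel (R : realType) (x y : Cplx R) : \bar R :=
  - lne (modc (x - y)%R)%:E.

Definition log_energy (R : realType) (mu : probability (BorelC R) R) : \bar R :=
  \int[mu]_x \int[mu]_y log_kernel x y.

(* [E] is meant to be compact, hence Borel. *)
Definition supported_in (R : realType) (E : set (Cplx R))
    (mu : probability (BorelC R) R) : Prop :=
  mu (~` E) = 0.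

Definition robin (R : realType) (E : set (Cplx R)) : \bar R :=
  ereal_inf [set log_energy mu | mu in [set mu | supported_in E mu]].

Definition capacity (R : realType) (E : set (Cplx R)) : \bar R :=
  expeR (- robin E).

Definition is_equilibrium_measure (R : realType) (E : set (Cplx R))
    (rho : probability (BorelC R) R) : Prop :=
  [/\ 0 < capacity E, supported_in E rho & log_energy rho = robin E].

(* In what follows [rho] is meant to be the equilibrium measure of [E]. *)
Definition green (R : realType) (E : set (Cplx R))
    (rho : probability (BorelC R) R) (z : Cplx R) : \bar R :=
  robin E - \int[rho]_(x in E) log_kernel x z.

Definition is_regular (R : realType) (E : set (Cplx R))
    (rho : probability (BorelC R) R) : Prop :=
  (forall z, E z -> green E rho z = 0) /\ continuous (green E rho).

(* The Wirtinger derivative (d/dx - i d/dy) / 2 of a real-valued function. *)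
Definition dz (R : realType) (u : Cplx R -> R) (w : Cplx R) : Cplx R :=
  (2^-1 * ((derive1 (fun t : R => u (t +i* complex.Im w)) (complex.Re w))%:C
      - (0 +i* 1) * (derive1 (fun t : R => u (complex.Re w +i* t))
                (complex.Im w))%:C))%R.

(* The Green function is finite and smooth off [E], so that neither [fine] nor
   the total derivative operator introduces spurious values there. *)
Definition critical_points (R : realType) (E : set (Cplx R))
    (rho : probability (BorelC R) R) : set (Cplx R) :=
  [set w | ~ E w /\ dz (fun z => fine (green E rho z)) w = 0%R].

(* The terms are nonnegative, as [esum] requires, since the Green function is. *)
Definition PW (R : realType) (E : set (Cplx R))
    (rho : probability (BorelC R) R) : \bar R :=
  \esum_(w in critical_points E rho) green E rho w.

(* Main.v *)
(* The usual proof compares the equilibrium measures of [E] and of the preimage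
   of [-M, M] under the Chebyshev polynomial, [M] being its norm. Here that
   measure is replaced by finite averages over level sets.

   Let [g] be the Green function, [gam] the Robin constant and [P] the real part
   of the Chebyshev polynomial, again of norm at most [M]. For [|c| < M], if
   [P - c = q Q] with [q > 0] on [E], then [P - e Q] beats [P] for small [e > 0].
   Hence [P - c] has only real roots, all in the convex hull of [E], and at most
   one in each gap of [E]. As [g] vanishes on [E] and its maximum over a gap is
   attained at a critical point, the sum of [g] over the roots of [P - c] is at
   most [PW].

   Move the roots [y] of [P - c] to [y + i d]: by uniform continuity the sum of
   [g] changes little, and it equals
   [n gam + \int log |P (x - i d) - c| d rho(x)].
   Take for [c / M] the [N] zeros of the [N]th classical Chebyshev polynomial.
   With [P (x - i d) / M = (z + 1 / z) / 2], the product of the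
   [|P (x - i d) - c|] is [(M / 2) ^ N |z ^ N + z ^ - N|], and [|z|] is bounded
   away from [1] by some amount depending on [d], so it is at least
   [(M / 2) ^ N] once [N] is large. Averaging over the values of [c] gives
   [n gam + log (M / 2) <= PW]. *)

Require Import Defs.
From HB Require Import structures.
From mathcomp Require Import all_boot all_order all_algebra complex.
From mathcomp Require Import all_classical all_reals all_analysis.
From mathcomp Require Import measurable_realfun zify ring lra.
Set Implicit Arguments.
Unset Strict Implicit.
Unset Printing Implicit Defensive.

Import Order.TTheory GRing.Theory Num.Theory.
Import numFieldNormedType.Exports.
Import ComplexField.Normc.

Local Open Scope classical_set_scope.
Local Open Scope complex_scope.
Local Open Scope ring_scope.

(** * Extremal polynomials on a real compact set and the roots of their level sets *)

(** The Chebyshev property over the reals, stated through bounds instead of a supremum. Taking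
    [Q := P] shows that [M] is the least bound of [P] on [A]. *)
Definition extremal (R : realType) (A : set R) (n : nat) (M : R)
    (P : {poly R}) : Prop :=
  [/\ P \is monic, size P = n.+1, forall x, A x -> `|P.[x]| <= M &
    forall (Q : {poly R}) (L : R), Q \is monic -> size Q = n.+1 ->
      (forall x, A x -> `|Q.[x]| <= L) -> M <= L].

(* [P - e Q = (1 - t) P + t c] with [t = e / q] in (0, 1], which is uniformly
   smaller than [M] on [A]: a competitor contradicting minimality. *)
Lemma no_positive_factor (R : realType) (A : set R) (n : nat) (M : R)
    (P q Q : {poly R}) (c : R) :
  compact A -> A !=set0 -> extremal A n M P -> `|c| < M ->
  P - c%:P = q * Q -> (1 < size q)%N -> (forall x, A x -> 0 < q.[x]) -> False.
Proof.
move=> cA A0 [Pm sP PM minP] cM Pc q1 qpos.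
have cq : {within A, continuous (horner q)}.
  by apply: continuous_subspaceT => x; exact: continuous_horner.
have [a /set_mem Aa amin] := compact_EVT_min A0 cA cq.
have [b /set_mem Ab bmax] := compact_EVT_max A0 cA cq.
have qa := qpos _ Aa; have qb := qpos _ Ab.

pose e := q.[a] / 2.
have e0 : 0 < e by rewrite divr_gt0.
have sQ : (size Q <= n)%N.
  have [->|Q0] := eqVneq Q 0; first by rewrite size_poly0.
  have q0 : q != 0 by rewrite -size_poly_gt0 (ltn_trans _ q1).
  have : (size (q * Q)%R <= n.+1)%N.
    rewrite -Pc (leq_trans (size_polyD _ _))// geq_max sP leqnn size_polyN.
    by rewrite (leq_trans (size_polyC_leq1 _)).
  by rewrite size_mul//; move: q1 Q0; rewrite -size_poly_gt0;
    move: (size q) (size Q) => u v; lia.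
have sQe : (size (- (e *: Q))%R < size P)%N.
  by rewrite size_polyN sP ltnS (leq_trans (size_scale_leq _ _)).
(* With [t = e / q.[x]], the bound [(1 - t) * M + t * |c|] equals [M - t * (M - |c|)], and [t] is
   smallest where [q] is largest, at [b]. Choosing [e] from the minimum of [q] keeps [t] below 1. *)
pose L := M - e / q.[b] * (M - `|c|).
have : M <= L.
  apply: (minP (P - e *: Q)); rewrite ?size_polyDl// ?monicE ?lead_coefDl//.
  move=> x Ax.
  have qx := qpos _ Ax; have qxb := bmax _ (mem_set Ax).
  have qxa := amin _ (mem_set Ax).
  pose t := e / q.[x].
  have t0 : 0 < t by rewrite divr_gt0.
  have t1 : t <= 1.
    by rewrite ler_pdivrMr// mul1r (le_trans _ qxa)// /e ler_pdivrMr//; lra.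
  have Px : P.[x] - c = q.[x] * Q.[x].
    by have := congr1 (horner^~ x) Pc; rewrite !hornerE.
  have -> : (P - e *: Q).[x] = (1 - t) * P.[x] + t * c.
    have -> : P.[x] = c + q.[x] * Q.[x] by rewrite -Px; lra.
    rewrite !hornerE -[P.[x]](subrK c) Px /t; field.
    by rewrite gt_eqF.
  have eb : e / q.[b] <= t by rewrite ler_pM2l// lef_pV2.
  rewrite (le_trans (ler_normD _ _))// (normrM (1 - t)) (normrM t).
  rewrite (ger0_norm (ltW t0)).
  rewrite ger0_norm ?subr_ge0//.
  have h1 : (1 - t) * `|P.[x]| <= (1 - t) * M.
    by rewrite ler_wpM2l ?subr_ge0// PM.
  have h2 : e / q.[b] * (M - `|c|) <= t * (M - `|c|).
    by rewrite ler_wpM2r// subr_ge0 ltW.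
  by rewrite /L; lra.
rewrite leNgt => /negP; apply; rewrite /L ltrBlDr ltrDl mulr_gt0 ?divr_gt0//.
by rewrite subr_gt0.
Qed.
(** [D] splits over the complex numbers. A nonreal root [a + b i] occurs with its conjugate, and the
    pair yields the real factor [(X - a)^2 + b^2], positive on the whole line. *)
Lemma real_factors (R : realType) (D : {poly R}) :
  D \is monic ->
  (forall q Q : {poly R}, D = q * Q -> (1 < size q)%N ->
     ~ forall x, 0 < q.[x]) ->
  exists rs : seq R, D = \prod_(y <- rs) ('X - y%:P).
Proof.
move=> Dm noq; pose Dc := map_poly (real_complex R) D.
have [r Dr] := closed_field_poly_normal Dc.
have {}Dr : Dc = \prod_(z <- r) ('X - z%:P).
  by rewrite Dr lead_coef_map (eqP Dm) rmorph1 scale1r.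
have r0 z : z \in r -> complex.Im z = 0.
  move=> zr; apply/eqP/negPn/negP => b0.
  have zD : root Dc z by rewrite Dr root_prod_XsubC.
  have zD' : root Dc (conjc z).
    by rewrite -complex_root_conj /Dc -map_poly_comp (eq_map_poly (@conjc_real R)).
  have zz' : conjc z != z.
    by case: (z) b0 => a b /= b0; rewrite eq_complex /= eqxx /= eqNr.
  pose a := complex.Re z; pose b := complex.Im z.
  pose q : {poly R} := ('X - a%:P) ^+ 2 + (b ^+ 2)%:P.
  have qz : map_poly (real_complex R) q = ('X - z%:P) * ('X - (conjc z)%:P).
    rewrite /q rmorphD rmorphXn rmorphB /= map_polyX !map_polyC /=.
    have -> : z = a%:C + b *i by rewrite /a /b; case: (z) => u v; simpc.
    have -> : conjc (a%:C + b*i) = a%:C - b*i by simpc.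
    have -> : ((b ^+ 2)%:C)%:P = - (b*i)%:P ^+ 2 :> {poly R[i]}.
      rewrite -rmorphXn -rmorphN /=; congr (_%:P).
      by rewrite !expr2; apply/eqP; rewrite eq_complex /= !mul0r !mulr0 addr0 sub0r !opprK oppr0 !eqxx.
    by rewrite !rmorphD !rmorphN /=; ring.
  have : q %| D.
    rewrite -(dvdp_map (real_complex R)) qz.
    have /factor_theorem[D1 D1E] := zD.
    rewrite -/Dc D1E [D1 * _]mulrC dvdp_mul2l ?polyXsubC_eq0//.
    move: zD'; rewrite D1E rootM root_XsubC (negbTE zz') orbF.
    by rewrite dvdp_XsubCl.
  move=> /dvdpP[Q DQ]; apply: (noq q Q); first by rewrite mulrC.
    rewrite /q size_polyDl size_exp_XsubC// (leq_ltn_trans (size_polyC_leq1 _))//.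
  by move=> x; rewrite !hornerE ltr_wpDl ?sqr_ge0// exprn_even_gt0.
exists (map (@complex.Re R) r).
apply: (@map_poly_inj R _ (real_complex R)); rewrite -/Dc Dr.
rewrite rmorph_prod big_map; apply: eq_big_seq => z /r0 z0.
rewrite rmorphB /= map_polyX map_polyC /=; congr (_ - _%:P).
by case: z z0 => u v /= ->.
Qed.

(** Equivalently, [y] and [z] lie in the same connected component of the complement of [A] in the
    line. *)
Definition sign_linked (R : realType) (A : set R) (y z : R) : Prop :=
  forall x, A x -> 0 < (x - y) * (x - z).

(** Two linked roots would give the quadratic factor [(X - y) (X - z)], positive on [A]. The
    cofactor [F] absorbs the roots already treated by the induction. *)
Lemma prod_pairwise (R : realType) (A : set R) (rs : seq R) (D F : {poly R}) :
  D = F * \prod_(y <- rs) ('X - y%:P) ->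
  (forall q Q : {poly R}, D = q * Q -> (1 < size q)%N ->
     ~ forall x, A x -> 0 < q.[x]) ->
  pairwise (fun y z => ~~ `[< sign_linked A y z >]) rs.
Proof.
move=> + noq; elim: rs F => //= y rs IH F DE; apply/andP; split; last first.
  by apply: (IH (F * ('X - y%:P))); rewrite DE big_cons; ring.
apply/allP => z zrs; apply/asboolPn => yz.
apply: (noq (('X - y%:P) * ('X - z%:P))
  (F * \prod_(w <- rem z rs) ('X - w%:P))).
- by rewrite DE big_cons (big_rem z)//=; ring.
- by rewrite size_mul ?polyXsubC_eq0// !size_XsubC.
- by move=> x Ax; rewrite !hornerE yz.
Qed.

(** With no point of [A] on one side of a root [y], either [X - y] or its opposite is a factor
    positive on [A]. *)
Lemma prod_hull (R : realType) (A : set R) (rs : seq R) (D : {poly R}) :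
  D = \prod_(y <- rs) ('X - y%:P) ->
  (forall q Q : {poly R}, D = q * Q -> (1 < size q)%N ->
     ~ forall x, A x -> 0 < q.[x]) ->
  forall y, y \in rs -> (exists2 x, A x & x <= y) /\ (exists2 x, A x & y <= x).
Proof.
move=> DE noq y yrs.
pose Q := \prod_(w <- rem y rs) ('X - w%:P).
have DQ : D = ('X - y%:P) * Q by rewrite DE (big_rem y).
split; apply/not_exists2P => noA.
- apply: (noq ('X - y%:P) Q) => //; first by rewrite size_XsubC.
  by move=> x Ax; rewrite hornerXsubC subr_gt0 ltNge; apply/negP; case: (noA x).
- apply: (noq (- ('X - y%:P)) (- Q)); first by rewrite mulrNN.
    by rewrite size_polyN size_XsubC.
  move=> x Ax; rewrite hornerN hornerXsubC opprB subr_gt0 ltNge.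
  by apply/negP; case: (noA x).
Qed.

(* Each point with a positive value is charged to its own element of [W]. *)
Lemma sum_le_linked (R : realType) (A W : set R) (g : R -> R) (rs : seq R) :
  pairwise (fun y z => ~~ `[< sign_linked A y z >]) rs ->
  (forall y, y \in rs -> 0 < g y ->
     exists w, [/\ W w, g y <= g w & sign_linked A y w]) ->
  exists ws : seq R, [/\ uniq ws, forall w, w \in ws -> W w &
    \sum_(y <- rs) g y <= \sum_(w <- ws) g w].
Proof.
(* The induction also records, for each chosen [w], an entry of [rs] linked to it; this is what
   yields distinctness. *)
move=> prs hw; suff [ws [? h ?]] : exists ws : seq R, [/\ uniq ws,
    forall w, w \in ws -> W w /\ exists2 y, y \in rs & sign_linked A y w &
    \sum_(y <- rs) g y <= \sum_(w <- ws) g w].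
  by exists ws; split=> // w /h[].
elim: rs prs hw => [|y rs IH] /=; first by exists [::].
move=> /andP[/allP yrs prs] hw.
have {}[|ws [uws hws sws]] := IH prs.
  by move=> z zrs; apply: hw; rewrite inE zrs orbT.
have [gy|gy] := leP (g y) 0.
  exists ws; split => //; last by rewrite big_cons; lra.
  move=> w /hws[Ww [z zrs zw]]; split=> //; exists z => //.
  by rewrite inE zrs orbT.
have [|w [Ww gw yw]] := hw y _ gy; first by rewrite inE eqxx.
exists (w :: ws); split; last by rewrite !big_cons; lra.
(* If [w] already served [z], then [y] and [z] are both linked to [w], hence to each other after
   division by [(x - w)^2]. *)
- rewrite /= uws andbT; apply/negP => /hws[_ [z zrs zw]].
  have /asboolPn := yrs z zrs; apply => x Ax.
  have := mulr_gt0 (yw x Ax) (zw x Ax).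
  rewrite mulrACA pmulr_lgt0// -expr2 exprn_even_gt0//=.
  by move: (yw x Ax); rewrite lt0r mulf_eq0 negb_or => /andP[/andP[]].
- move=> v; rewrite inE => /orP[/eqP ->|/hws[Wv [z zrs zv]]].
    by split=> //; exists y => //; rewrite inE eqxx.
  by split=> //; exists z => //; rewrite inE zrs orbT.
Qed.

(** * Zeros of the classical Chebyshev polynomials and the Joukowski map *)

Lemma normcE_R (R : realType) (z : R[i]) : `|z| = (normc z)%:C.
Proof. by rewrite normc_def; case: z. Qed.

(* With [2 w z = z^2 + 1], each factor [w - Re u] for [u] on the unit circle is
   [(z - u) (z - conj u) / 2 z]; the [u] are the [N]-th roots of [i]. *)
Lemma chebyshev_nodes (R : realType) (N : nat) :
  (0 < N)%N -> exists cs : seq R,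
  [/\ size cs = N, forall c, c \in cs -> `|c| < 1 &
      forall w z : R[i], z != 0 -> 2 * w * z = z ^+ 2 + 1 ->
        (\prod_(c <- cs) (w - c%:C)) * (2 * z) ^+ N = z ^+ N.*2 + 1].
Proof.
move=> N0; pose p : {poly R[i]} := 'X^N - ('i%C)%:P.
have [us pE] : exists us : seq R[i], p = \prod_(u <- us) ('X - u%:P).
  have [us pE] := closed_field_poly_normal p.
  by exists us; rewrite pE (lead_coefXnsubC _ N0) scale1r.
have sus : size us = N.
  have : size p = (size us).+1 by rewrite pE size_prod_XsubC.
  by rewrite size_XnsubC// => -[].
have usN u : u \in us -> u ^+ N = 'i%C.
  rewrite -root_prod_XsubC -pE /root /p !hornerE subr_eq0.
  by move=> /eqP.
have norm1 u : u \in us -> u * conjc u = 1.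
  move=> /usN uN; rewrite -sqr_normc.
  have : `|u| ^+ N == 1.
    by rewrite -normrX uN normc_def /= expr0n /= expr1n add0r sqrtr1.
  rewrite pexpr_eq1 ?normr_ge0// => /eqP ->.
  by rewrite expr1n.
have uu (u : R[i]) : u + conjc u = 2 * (complex.Re u)%:C by rewrite addcJ.
have reim u : u \in us -> complex.Re u ^+ 2 + complex.Im u ^+ 2 = 1.
  move=> /norm1; case: (u) => a b /= /(congr1 (@complex.Re R)) /= h.
  by rewrite !expr2; lra.
(* A real [u] has only real powers, never [i]; this makes [|Re u| < 1] strict. *)
have im u : u \in us -> complex.Im u != 0.
  move=> uus; apply/negP => /eqP u0; have := usN _ uus.
  have -> : u = (complex.Re u)%:C by case: (u) u0 => a b /= ->.
  by rewrite -rmorphXn /= => -[_ /eqP]; rewrite eq_sym oner_eq0.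
exists (map (@complex.Re R) us); split; first by rewrite size_map.
  move=> _ /mapP[u uus ->]; rewrite -ltr_sqr ?nnegrE// ?normr_ge0//.
  rewrite expr1n real_normK ?num_real// -(reim u uus) ltrDl.
  by rewrite exprn_even_gt0//= im.
move=> w z z0 wz.
have -> : (2 * z) ^+ N = \prod_(u <- us) (2 * z).
  by rewrite big_const_seq count_predT sus iter_mulr_1.
rewrite big_map -big_split /=.
have -> : \prod_(u <- us) ((w - (complex.Re u)%:C) * (2 * z)) =
    \prod_(u <- us) ((z - u) * conjc (conjc z - u)).
  apply: eq_big_seq => u uus.
  rewrite rmorphB /= conjcK.
  transitivity (z ^+ 2 + 1 - (u + conjc u) * z); last first.
    by rewrite -(norm1 _ uus); ring.
  by rewrite -wz uu; ring.
rewrite big_split /= -rmorph_prod /=.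
have pz (v : R[i]) : \prod_(u <- us) (v - u) = v ^+ N - 'i%C.
  transitivity (p.[v]); last by rewrite /p !hornerE.
  by rewrite pE horner_prod; apply: eq_bigr => u _; rewrite !hornerE.
rewrite !pz.
have -> : conjc (conjc z ^+ N - 'i%C) = z ^+ N + 'i%C.
  rewrite rmorphB rmorphXn /= conjcK; congr (_ + _).
  by apply/eqP; rewrite eq_complex /= oppr0 opprK !eqxx.
by rewrite -subr_sqr sqr_i opprK -exprM muln2.
Qed.

Lemma normc_real (R : realType) (x : R) : normc x%:C = `|x|.
Proof. by rewrite /= expr0n /= addr0 sqrtr_sqr. Qed.

Lemma normc_ge0 (R : realType) (z : R[i]) : 0 <= normc z.
Proof. by case: z => a b; exact: sqrtr_ge0. Qed.

Lemma normcJ_R (R : realType) (z : R[i]) : normc (conjc z) = normc z.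
Proof. by case: z => a b /=; rewrite sqrrN. Qed.

Lemma normcX (R : realType) (z : R[i]) (n : nat) : normc (z ^+ n) = normc z ^+ n.
Proof.
by elim: n => [|n IH]; rewrite ?expr0 ?normc1// !exprS normcM IH.
Qed.

(* Of the two solutions [z], [1 / z] take the one with [r = |z| >= 1], and
   compare [w] with [c = Re z / r]: then
   [2 (w - c) = (r - 1) z / r + (1 / r - 1) conj z / r]. *)
Lemma joukowski (R : realType) (w : R[i]) (eta : R) :
  0 < eta -> (forall c : R, `|c| < 1 -> eta <= normc (w - c%:C)) ->
  exists z : R[i], 2 * w * z = z ^+ 2 + 1 /\ 1 + eta <= normc z.
Proof.
move=> eta0 hw.
have [z [wz z1]] : exists z : R[i], 2 * w * z = z ^+ 2 + 1 /\ 1 <= normc z.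
  (* The two solutions are [w + s] and [w - s]; their product is 1, so one of them has modulus at
     least 1. *)
  pose s := sqrtc (w ^+ 2 - 1).
  have ss : s ^+ 2 = w ^+ 2 - 1 by rewrite sqr_sqrtc.
  have [h|h] := leP 1 (normc (w + s)).
    exists (w + s); split=> //; rewrite sqrrD ss; ring.
  exists (w - s); split; first by rewrite sqrrB ss; ring.
  have : normc (w + s) * normc (w - s) = 1.
    by rewrite -normcM mulrC -subr_sqr ss opprB addrC subrK normc1.
  have := normc_ge0 (w - s); have := normc_ge0 (w + s); nra.
exists z; split=> //; set r := normc z in z1 *.
have r0 : 0 < r by lra.
have z0 : z != 0 by apply: contraTneq z1 => z0; rewrite /r z0 normc0 -ltNge ltr01.
have zz : z * conjc z = (r ^+ 2)%:C.
  by rewrite -sqr_normc normcE_R rmorphXn.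
pose c := complex.Re z / r.
have c1 : `|c| <= 1.
  rewrite /c normrM normfV (gtr0_norm r0) ler_pdivrMr// mul1r.
  by have := normc_ge_Re z; rewrite normcE_R lecR.
(* The hypothesis covers only [|c| < 1], whereas [|c| = 1] is possible here: apply it to [t * c]
   with [t = 1 / (1 + d)] and let [d] tend to 0. *)
have etac : eta <= normc (w - c%:C).
  apply/ler_addgt0Pr => d d0.
  pose t := (1 + d)^-1.
  have t0 : 0 < t by rewrite invr_gt0; lra.
  have td : t * (1 + d) = 1 by rewrite mulVf// gt_eqF//; lra.
  have t1 : t < 1 by nra.
  have tc : `|t * c| < 1.
    rewrite normrM (gtr0_norm t0).
    by apply: le_lt_trans t1; rewrite ler_piMr// ltW.
  apply: (le_trans (hw _ tc)).
  have -> : w - (t * c)%:C = (w - c%:C) + ((1 - t) * c)%:C.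
    by rewrite mulrBl mul1r rmorphB /=; ring.
  rewrite (le_trans (le_normcD _ _))// lerD2l normc_real normrM.
  rewrite ger0_norm; last by lra.
  by rewrite (le_trans (ler_piMr _ c1))//; nra.
have rC : r%:C != 0 :> R[i] by rewrite (inj_eq (@complexI R)) gt_eqF.
have rM (a b : R) : (a * b)%:C = a%:C * b%:C :> R[i] := rmorphM _ a b.
have r1 : (r - 1)%:C = r%:C - 1 :> R[i] := rmorphB _ r 1.
have e2 : 2 * (w - c%:C) * r%:C * r%:C =
    (r - 1)%:C * z * r%:C - (r - 1)%:C * conjc z.
  apply: (mulIf z0).
  have -> : 2 * (w - c%:C) * r%:C * r%:C * z =
     (2 * w * z) * r%:C ^+ 2 - (2 * (c * r)%:C) * r%:C * z.
    by rewrite (rM c r); ring.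
  rewrite /c divfK ?gt_eqF// -addcJ wz.
  have -> : ((r - 1)%:C * z * r%:C - (r - 1)%:C * conjc z) * z =
     (r%:C - 1) * r%:C * z ^+ 2 - (r%:C - 1) * (z * conjc z).
    by rewrite r1; ring.
  rewrite zz.
  have -> : (z + conjc z) * r%:C * z = r%:C * z ^+ 2 + r%:C * (z * conjc z) by ring.
  by rewrite zz expr2 (rM r r); ring.
have := congr1 (@normc R) e2; rewrite !normcM normc_real (gtr0_norm r0).
have n2 : normc (2 : R[i]) = 2 by rewrite -[2]/(2%:R) -(rmorph_nat (real_complex R)) normc_real ger0_norm.
rewrite n2 => e3.
have : normc ((r - 1)%:C * z * r%:C - (r - 1)%:C * conjc z) <=
    (r - 1) * r * r + (r - 1) * r.
  rewrite (le_trans (le_normcD _ _))// normcN !normcM !normc_real normcJ_R -/r.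
  by rewrite (gtr0_norm r0) ger0_norm ?subr_ge0.
rewrite -e3 => e4.
have e5 : 2 * eta * r * r <= (r - 1) * r * r + (r - 1) * r.
  by apply: le_trans e4; do 2 apply: ler_wpM2r (ltW r0) _ _ _; rewrite ler_pM2l.
have e6 : 2 * eta * r <= (r - 1) * r + (r - 1) by rewrite -(ler_pM2r r0); nra.
(* As [r >= 1], [(r - 1) (r + 1) <= 2 r (r - 1)], hence [eta <= r - 1]. *)
rewrite -lerBrDl -(ler_pM2r r0); nra.
Qed.

Lemma bernoulli_ineq (R : realDomainType) (x : R) (n : nat) :
  0 <= x -> 1 + x *+ n <= (1 + x) ^+ n.
Proof.
move=> x0; elim: n => [|n IH]; first by rewrite mulr0n addr0 expr0.
rewrite exprS mulrS; have := mulrn_wge0 n x0; nra.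
Qed.

(** The nodes depend on [eta] alone: [|z| >= 1 + eta], so by Bernoulli's inequality a degree with
    [2 <= eta * N] gives [|z|^N >= 2]. For [t = |z|^N] one then has
    [|z^(2 N) + 1| >= t^2 - 1 >= t]. *)
Lemma chebyshev_lower_bound (R : realType) (eta : R) :
  0 < eta -> exists cs : seq R,
  [/\ (0 < size cs)%N, forall c, c \in cs -> `|c| < 1 &
    forall w : R[i], (forall c : R, `|c| < 1 -> eta <= normc (w - c%:C)) ->
      (2^-1) ^+ size cs <= normc (\prod_(c <- cs) (w - c%:C))].
Proof.
move=> eta0; have [N etaN] : exists N : nat, 2 <= eta *+ N.+1.
  exists (Num.truncn (2 / eta)).
  by rewrite -[eta *+ _]mulr_natl -ler_pdivrMr// ltW// truncnS_gt// divr_ge0// ltW.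
have [cs [scs cs1 hcs]] := @chebyshev_nodes R N.+1 isT.
exists cs; rewrite scs; split=> // w /(joukowski eta0)[z [wz z1]].
have r0 : 0 < normc z by lra.
have z0 : z != 0 by apply: contraTneq r0 => ->; rewrite normc0 ltxx.
have rN : 2 <= normc z ^+ N.+1.
  apply: (@le_trans _ _ ((1 + eta) ^+ N.+1)); last by rewrite lerXn2r ?nnegrE; lra.
  by rewrite (le_trans _ (bernoulli_ineq _ _))//; lra.
have := congr1 (@normc R) (hcs w z z0 wz).
rewrite normcM normcX normcM.
have -> : normc (2 : R[i]) = 2 by rewrite -[2]/(2%:R) -(rmorph_nat (real_complex R)) normc_real ger0_norm.
rewrite exprMn mulrA => h.
have h1 : normc z ^+ N.+1 <= normc (z ^+ N.+1.*2 + 1).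
  have : normc (z ^+ N.+1.*2) <= normc (z ^+ N.+1.*2 + 1) + 1.
    by rewrite -{1}(addrK 1 (z ^+ _)) (le_trans (le_normcD _ _))// normcN normc1.
  by rewrite normcX -muln2 exprM; nra.
rewrite -(ler_pM2r (_ : 0 < 2 ^+ N.+1 * normc z ^+ N.+1)); last first.
  by rewrite mulr_gt0// exprn_gt0.
by rewrite mulrA -exprMn mulVf ?pnatr_eq0// expr1n mul1r mulrA h.
Qed.

(** * Topology and Borel measurability of the complex plane *)

(** Radii of balls in [Cplx R] are elements of [R[i]]; a positive one has zero imaginary part, so
    real radii suffice. *)
Lemma nbhs_normcP (R : realType) (z : Cplx R) (Q : set (Cplx R)) :
  nbhs z Q <-> exists2 d : R, 0 < d & forall y, normc (z - y) < d -> Q y.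
Proof.
split.
  move=> /(proj1 (nbhs_normP z Q))[e e0 zQ]; have : 0 < e := e0.
  rewrite ltcE => /andP[/eqP ie re].
  exists (complex.Re e) => // y zy; apply: zQ => /=.
  by rewrite normcE_R ltcE /= ie eqxx.
move=> [d d0 zQ]; apply: (proj2 (nbhs_normP z Q)); exists (d%:C); first by rewrite /= ltcR.
by move=> y /=; rewrite normcE_R ltcR; exact: zQ.
Qed.

Lemma continuous_normcB (R : realType) (z : Cplx R) :
  continuous (fun x : Cplx R => normc (x - z)).
Proof.
move=> x A /nbhs_ballP[e e0 eA]; apply/nbhs_normcP; exists e => // y xy.
apply: eA; rewrite /ball /=.
apply: le_lt_trans xy.
have h1 : normc (x - z) <= normc (x - y) + normc (y - z).
  by rewrite -{1}(subrK y x) -(addrA (x - y)) le_normcD.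
have h2 : normc (y - z) <= normc (x - y) + normc (x - z).
  rewrite -(normcN (x - y)) opprB -{1}(subrK x y) -(addrA (y - x)).
  exact: le_normcD.
by rewrite ler_norml; apply/andP; split; lra.
Qed.

Lemma continuous_horizontal (R : realType) (s : R) :
  continuous (fun t : R => t +i* s : Cplx R).
Proof.
move=> t A /nbhs_normcP[d d0 tA].
apply/nbhs_ballP; exists d => // u tu; apply: tA.
suff -> : (t +i* s) - (u +i* s) = (t - u)%:C :> R[i].
  by rewrite normc_real.
by apply/eqP; rewrite eq_complex /= subrr !eqxx.
Qed.

Lemma continuous_complex_Re (R : realType) :
  continuous (fun z : Cplx R => complex.Re z).
Proof.
move=> z A /nbhs_ballP[e e0 eA]; apply/nbhs_normcP; exists e => // y zy.
apply: eA; rewrite /ball /=.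
apply: le_lt_trans zy; have := normc_ge_Re (z - y).
by rewrite normcE_R lecR raddfB.
Qed.

Lemma closed_measurableC (R : realType) (E : set (Cplx R)) :
  closed E -> measurable (E : set (BorelC R)).
Proof.
move=> cE; rewrite -(setCK E); apply: measurableC.
by apply: sub_sigma_algebra; rewrite /= openC.
Qed.

Lemma continuous_measurableC (R : realType) (f : Cplx R -> R) (E : set (Cplx R)) :
  continuous f -> measurable_fun (E : set (BorelC R)) f.
Proof.
move=> /continuousP cf; apply: (@measurable_funTS _ _ (BorelC R)).
apply: (measurability _ (RGenOpens.measurableE R)).
move=> _ [_ [a [b ->] <-]]; rewrite setTI; apply: sub_sigma_algebra.
exact/cf/interval_open.
Qed.

Lemma compactC_measurable (R : realType) (E : set (Cplx R)) :
  compact E -> measurable (E : set (BorelC R)).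
Proof.
move=> cE; apply: closed_measurableC; apply: compact_closed cE; exact: norm_hausdorff.
Qed.

(** * Logarithmic potentials off the support *)

Lemma support_full (R : realType) (E : set (Cplx R))
    (rho : probability (BorelC R) R) :
  compact E -> supported_in E rho -> rho E = 1%E.
Proof.
move=> /compactC_measurable mE rhoE.
rewrite -(setCK E) probability_setC ?rhoE ?sube0//; exact: measurableC.
Qed.

(** On the compact set [E] the distance to [z] lies between two positive constants, so its logarithm
    is bounded. *)
Lemma integrable_ln_normcB (R : realType) (E : set (Cplx R))
    (rho : probability (BorelC R) R) (z : Cplx R) :
  compact E -> supported_in E rho -> ~ E z ->
  rho.-integrable E (EFin \o (fun x : BorelC R => ln (normc ((x : Cplx R) - z)))).
Proof.
move=> cE rhoE Ez; apply: measurable_bounded_integrable.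
- exact: compactC_measurable.
- by apply: le_lt_trans (ltry 1); rewrite -(support_full cE rhoE).
- apply: (measurableT_comp (@measurable_ln R)).
  by apply: continuous_measurableC; exact: continuous_normcB.
have [->|/set0P E0] := eqVneq E set0.
  by exists 0; split=> // K K0 x [].
have cf : {within E, continuous (fun x : Cplx R => normc (x - z))}.
  by apply: continuous_subspaceT => x; exact: continuous_normcB.
have [a /set_mem Ea amin] := compact_EVT_min E0 cE cf.
have [b /set_mem Eb bmax] := compact_EVT_max E0 cE cf.
have pos x : E x -> 0 < normc (x - z).
  move=> Ex; rewrite lt0r normc_ge0 andbT; apply/eqP => /eq0_normc/eqP.
  by rewrite subr_eq0 => /eqP xz; apply: Ez; rewrite -xz.
exists (`|ln (normc (a - z))| + `|ln (normc (b - z))|); split=> // K K0 x Ex.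
have h1 : ln (normc (a - z)) <= ln (normc (x - z)).
  by rewrite ler_ln ?posrE ?pos// amin// inE.
have h2 : ln (normc (x - z)) <= ln (normc (b - z)).
  by rewrite ler_ln ?posrE ?pos// bmax// inE.
rewrite /= (le_trans _ (ltW K0))// ler_norml.
have := ler_norm (ln (normc (b - z))).
have := lerNnormlW (lexx `|ln (normc (a - z))|).
have := normr_ge0 (ln (normc (b - z))); have := normr_ge0 (ln (normc (a - z))).
by move=> ? ? ? ?; apply/andP; split; lra.
Qed.

Lemma green_offE (R : realType) (E : set (Cplx R))
    (rho : probability (BorelC R) R) (gam : R) (z : Cplx R) :
  compact E -> supported_in E rho -> robin E = gam%:E -> ~ E z ->
  green E rho z =
  (gam + \int[rho]_(x in E) ln (normc ((x : Cplx R) - z)))%:E.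
Proof.
move=> cE rhoE robinE Ez; have iz := integrable_ln_normcB cE rhoE Ez.
rewrite /green robinE EFinD; congr (_ + _)%E.
rewrite /Rintegral fineK; last first.
  by apply: integrable_fin_num => //; exact: compactC_measurable.
have -> : (\int[rho]_(x in E) log_kernel x z =
    \int[rho]_(x in E) - (ln (normc ((x : Cplx R) - z)%R))%:E)%E.
  apply: eq_integral => x /set_mem Ex; rewrite /log_kernel lne_EFin//.
  rewrite lt0r normc_ge0 andbT; apply/eqP => /eq0_normc/eqP.
  by rewrite subr_eq0 => /eqP xz; apply: Ez; rewrite -xz.
by rewrite integralN ?oppeK//; exact: (integrable_add_def (compactC_measurable cE) iz).
Qed.

(** The sum equals [gam *+ size zs] plus the integral of the logarithm of the product, and [rho] has
    mass 1 on [E]. *)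
Lemma sum_green_ge (R : realType) (E : set (Cplx R))
    (rho : probability (BorelC R) R) (gam : R) (zs : seq (Cplx R)) (K : R) :
  compact E -> supported_in E rho -> robin E = gam%:E ->
  0 < K -> (forall z, z \in zs -> ~ E z) ->
  (forall x, E x -> K <= normc (\prod_(z <- zs) (x - z))) ->
  gam *+ size zs + ln K <= \sum_(z <- zs) fine (green E rho z).
Proof.
move=> cE rhoE robinE K0 Ezs EK.
have mE := compactC_measurable cE.
pose F (s : seq (Cplx R)) (x : BorelC R) : R :=
  \sum_(z <- s) ln (normc ((x : Cplx R) - z)).
have [iF ->] : rho.-integrable E (EFin \o F zs) /\
    \sum_(z <- zs) fine (green E rho z) =
    gam *+ size zs + \int[rho]_(x in E) F zs x.
  elim: zs Ezs {EK} => [|z s IH] Ezs.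
    have -> : F [::] = cst 0 by apply/funext => x; rewrite /F big_nil.
    split; first exact: finite_measure_integrable_cst.
    by rewrite big_nil mulr0n add0r Rintegral_cst// mul0r.
  have Ez : ~ E z by apply: Ezs; rewrite inE eqxx.
  have [|iF sF] := IH; first by move=> y ys; apply: Ezs; rewrite inE ys orbT.
  have -> : F (z :: s) = (fun x => ln (normc ((x : Cplx R) - z)) + F s x).
    by apply/funext => x; rewrite /F big_cons.
  have iz := integrable_ln_normcB cE rhoE Ez.
  split; first exact: integrableD iz iF.
  by rewrite big_cons sF (green_offE cE rhoE robinE)//= RintegralD// mulrS; lra.
rewrite lerD2l.
have -> : ln K = \int[rho]_(x in E) (cst (ln K) x).
  rewrite Rintegral_cst// -[LHS]mulr1; congr (_ * _).
  by rewrite -[RHS]/(fine (rho E)) (support_full cE rhoE).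
apply: le_Rintegral => //; first exact: finite_measure_integrable_cst.
move=> x Ex; rewrite /F /=.
have {}EK := EK x Ex.
have pos z : z \in zs -> 0 < normc (x - z).
  move=> zzs; rewrite lt0r normc_ge0 andbT; apply/eqP => /eq0_normc/eqP.
  by rewrite subr_eq0 => /eqP xz; apply: (Ezs _ zzs); rewrite -xz.
suff -> : \sum_(z <- zs) ln (normc (x - z)) = ln (normc (\prod_(z <- zs) (x - z))).
  by rewrite ler_ln// posrE (lt_le_trans K0).
elim: zs {Ezs EK iF} pos => [|z s IH] pos; first by rewrite !big_nil normc1 ln1.
rewrite !big_cons normcM lnM ?posrE; last 2 first.
- by apply: pos; rewrite inE eqxx.
- have : forall y, y \in s -> 0 < normc (x - y).
    by move=> y ys; apply: pos; rewrite inE ys orbT.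
  elim: s {IH pos} => [|y s IH] pos; first by rewrite big_nil normc1.
  rewrite big_cons normcM mulr_gt0 ?pos ?inE ?eqxx// IH// => v vs.
  by apply: pos; rewrite inE vs orbT.
by rewrite IH// => y ys; apply: pos; rewrite inE ys orbT.
Qed.

(** * Maxima in gaps, critical points, and continuity across the real axis *)

(* If the difference quotient diverges then [derive1] is the junk value [0]. *)
Lemma derive1_eq0 (R : realType) (f : R -> R) (c d : R) : 0 < d ->
  (forall h, 0 < h < d -> 0 <= (f (h + c) - f c) * (f (- h + c) - f c)) ->
  derive1 f c = 0.
Proof.
move=> d0 hd; rewrite /derive1; set q := fun h : R => _.
have [qc|/dvgP ->] := pselect (cvg (q @ 0^')); last by [].
apply/eqP/negPn/negP => l0; set l := lim _ in l0.
have : q @ 0^' --> l by exact: qc.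
move=> /cvgrPdist_lt /(_ (`|l| / 2)); rewrite divr_gt0 ?normr_gt0// => /(_ isT).
move=> /nbhs_ballP[e /= e0 he].
pose h := Num.min d e / 2.
have h0 : 0 < h by rewrite divr_gt0// lt_min d0.
have hmin : h < Num.min d e by rewrite ltr_pdivrMr// ltr_pMr ?ltr1n// lt_min d0.
move: hmin; rewrite lt_min => /andP[hd' he'].
have h1 : `|l - q h| < `|l| / 2.
  by apply: he; rewrite ?gt_eqF// /ball /= sub0r normrN gtr0_norm.
have h2 : `|l - q (- h)| < `|l| / 2.
  by apply: he; rewrite ?oppr_eq0 ?gt_eqF// /ball /= sub0r opprK gtr0_norm.
have : q h * q (- h) <= 0.
  rewrite -[q h]/(h^-1 * (f (h + c) - f c)).
  rewrite -[q (- h)]/((- h)^-1 * (f (- h + c) - f c)); have := hd h; rewrite h0 hd' => /(_ isT).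
  rewrite invrN mulrACA mulrN mulNr oppr_le0 => ?.
  by rewrite mulr_ge0// -expr2 sqr_ge0.
apply/negP; rewrite -ltNge; move: l0; rewrite neq_lt.
move=> /orP[ln|lp]; move: h1 h2; [rewrite (ltr0_norm ln)|rewrite (gtr0_norm lp)];
  by rewrite !ltr_norml => /andP[? ?] /andP[? ?]; nra.
Qed.

(** Since [f y > 0], [y] lies in a gap between consecutive points [a] and [b] of [A]. As [f]
    vanishes at [a] and [b], its maximum over the closed gap is attained inside. *)
Lemma gap_max (R : realType) (A : set R) (f : R -> R) (y : R) :
  compact A -> continuous f -> (forall x, A x -> f x = 0) ->
  (exists2 x, A x & x <= y) -> (exists2 x, A x & y <= x) -> 0 < f y ->
  exists w, [/\ ~ A w, f y <= f w, sign_linked A y w &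
    exists2 d, 0 < d & forall x, `|x - w| < d -> f x <= f w].
Proof.
move=> cA cf fA [x1 Ax1 x1y] [x2 Ax2 yx2] fy.
have cid : forall B : set R, {within B, continuous id}.
  by move=> B; apply: continuous_subspaceT => x; exact: cvg_id.
have c1 : compact (A `&` [set` `]-oo, y]]).
  by apply: compact_closedI => //; exact: interval_closed.
have c2 : compact (A `&` [set` `[y, +oo[]).
  by apply: compact_closedI => //; exact: interval_closed.
have [|a /set_mem[Aa ay] amax] := compact_EVT_max _ c1 (cid _).
  by exists x1; split=> //=; rewrite in_itv.
have [|b /set_mem[Ab yb] bmin] := compact_EVT_min _ c2 (cid _).
  by exists x2; split=> //=; rewrite in_itv /= yx2.
move: ay yb; rewrite /= !in_itv /= andbT => ay yb.
have {}ay : a < y.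
  by rewrite lt_neqAle ay andbT; apply: contraTneq fy => <-; rewrite fA ?ltxx.
have {}yb : y < b.
  by rewrite lt_neqAle yb andbT; apply: contraTneq fy => ->; rewrite fA ?ltxx.
have out x : A x -> x <= a \/ b <= x.
  move=> Ax; have [xy|yx] := leP x y.
    by left; apply: amax; rewrite inE; split=> //=; rewrite in_itv.
  by right; apply: bmin; rewrite inE; split=> //=; rewrite in_itv /= ltW.
have [|w wab wmax] := @EVT_max R f a b (ltW (lt_trans ay yb)).
  by apply: continuous_subspaceT => x; exact: cf.
have fyw : f y <= f w by apply: wmax; rewrite in_itv /= !ltW.
have fw : 0 < f w by rewrite (lt_le_trans fy).
move: wab; rewrite in_itv /= => /andP[aw wb].
have {}aw : a < w.
  by rewrite lt_neqAle aw andbT; apply: contraTneq fw => <-; rewrite fA ?ltxx.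
have {}wb : w < b.
  by rewrite lt_neqAle wb andbT; apply: contraTneq fw => ->; rewrite fA ?ltxx.
exists w; split=> //.
- by move=> /fA w0; rewrite w0 ltxx in fw.
- by move=> x /out[xa|bx]; nra.
exists (Num.min (w - a) (b - w)); first by rewrite lt_min !subr_gt0 aw wb.
move=> x; rewrite lt_min !ltr_norml => /andP[/andP[? ?] /andP[? ?]].
by apply: wmax; rewrite in_itv /=; apply/andP; split; lra.
Qed.

(** The horizontal derivative vanishes at a local maximum along the axis, the vertical one because
    [u] is even in the imaginary part. *)
Lemma dz_eq0 (R : realType) (u : Cplx R -> R) (w : R) :
  (forall z, u (conjc z) = u z) ->
  (exists2 d, 0 < d & forall x : R, `|x - w| < d -> u (x +i* 0) <= u (w +i* 0)) ->
  dz u (w +i* 0) = 0.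
Proof.
move=> ueven [d d0 umax]; rewrite /dz /=.
rewrite (@derive1_eq0 _ (fun t => u (t +i* 0)) w d)//; last first.
  move=> h /andP[h0 hd]; rewrite -mulrNN mulr_ge0// oppr_ge0 subr_le0 umax//.
  - by rewrite addrK gtr0_norm.
  - by rewrite addrK normrN gtr0_norm.
rewrite (@derive1_eq0 _ (fun t => u (w +i* t)) 0 1)//; last first.
  by move=> h _; rewrite !addr0 -(ueven (w +i* - h)) /= opprK -expr2 sqr_ge0.
by rewrite /= -[0%:C]/(0 : R[i]) mulr0 subr0 mulr0.
Qed.

(** Compactness of the segment makes the height [d] independent of [t]. *)
Lemma vertical_uniform (R : realType) (g : Cplx R -> R) (B e : R) :
  continuous g -> 0 < e ->
  exists2 d : R, 0 < d & forall t : R, `|t| <= B ->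
    g (t +i* d) <= g (t +i* 0) + e.
Proof.
move=> cg e0.
have := @segment_compact R (- B) B; rewrite compact_near_coveringP.
move=> /(_ R (0^'+) (fun d t => g (t +i* d) <= g (t +i* 0) + e) _)[].
  move=> x _.
  have : nbhs (g (x +i* 0)) (ball (g (x +i* 0)) (e / 2)).
    by apply: nbhsx_ballx; rewrite divr_gt0.
  move=> /cg/nbhs_normcP[r r0 hr].
  have near_le (s v : R) : `|x - s| < r / 2 -> `|v| < r / 2 ->
      `|g (x +i* 0) - g (s +i* v)| < e / 2.
    move=> xs vr; apply: hr.
    have -> : (x +i* 0) - (s +i* v) = (x - s)%:C + (0 +i* (- v)) :> R[i].
      by apply/eqP; rewrite eq_complex /= addr0 add0r !eqxx.
    rewrite (le_lt_trans (le_normcD _ _))// normc_real /= expr0n /= add0r.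
    by rewrite sqrtr_sqr normrN; lra.
  exists (ball x (r / 2), [set v | `|v| < r / 2]) => /=.
    split; first by apply: nbhsx_ballx; rewrite divr_gt0.
    exists (r / 2) => /=; first by rewrite divr_gt0.
    by move=> v /=; rewrite sub0r normrN.
  move=> [s v] [/= xs vr].
  have := near_le _ _ xs vr; have := near_le _ 0 xs.
  rewrite normr0 divr_gt0// => /(_ isT).
  by rewrite !ltr_norml => /andP[? ?] /andP[? ?]; lra.
move=> r /= r0 hr; exists (r / 2); first by rewrite divr_gt0.
move=> t tB; apply: hr; rewrite /= ?divr_gt0//.
  by rewrite sub0r normrN gtr0_norm ?divr_gt0//; lra.
by rewrite in_itv /= -ler_norml.
Qed.

(** * The Green function of a compact subset of the real line *)

Definition real_trace (R : realType) (E : set (Cplx R)) : set R :=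
  [set x | E (x +i* 0)].

Lemma real_point (R : realType) (E : set (Cplx R)) (z : Cplx R) :
  E `<=` [set z : Cplx R | complex.Im z = 0] -> E z -> z = (complex.Re z +i* 0).
Proof. by move=> Er /Er; case: z => a b /= ->. Qed.

Lemma compact_real_trace (R : realType) (E : set (Cplx R)) :
  compact E -> E `<=` [set z : Cplx R | complex.Im z = 0] ->
  compact (real_trace E).
Proof.
move=> cE Er; have -> : real_trace E = (fun z : Cplx R => complex.Re z) @` E.
  apply/seteqP; split=> [x Ex|_ [z Ez <-]]; first by exists (x +i* 0).
  by rewrite /real_trace /= -(real_point Er Ez).
apply: continuous_compact => //.
by apply: continuous_subspaceT => x; exact: continuous_complex_Re.
Qed.

Lemma green_conj (R : realType) (E : set (Cplx R))
    (rho : probability (BorelC R) R) (z : Cplx R) :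
  E `<=` [set z : Cplx R | complex.Im z = 0] ->
  green E rho (conjc z) = green E rho z.
Proof.
move=> Er; rewrite /green; congr (_ - _)%E; apply: eq_integral => x /set_mem Ex.
rewrite /log_kernel; congr (- lne _%:E)%E.
rewrite -(normcJ_R (x - z)) rmorphB /= [x in RHS](real_point Er Ex) /= oppr0.
by rewrite -(real_point Er Ex).
Qed.

Lemma green_fin_num (R : realType) (E : set (Cplx R))
    (rho : probability (BorelC R) R) (gam : R) (z : Cplx R) :
  compact E -> supported_in E rho -> robin E = gam%:E -> is_regular E rho ->
  green E rho z \is a fin_num.
Proof.
move=> cE rhoE robE [green0 _]; have [/green0 ->//|Ez] := pselect (E z).
by rewrite (green_offE cE rhoE robE Ez).
Qed.

Lemma continuous_fine_green (R : realType) (E : set (Cplx R))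
    (rho : probability (BorelC R) R) (gam : R) :
  compact E -> supported_in E rho -> robin E = gam%:E -> is_regular E rho ->
  continuous (fun z => fine (green E rho z)).
Proof.
move=> cE rhoE robE reg z.
have h : green E rho x @[x --> z] --> (fine (green E rho z))%:E.
  by rewrite fineK ?(green_fin_num _ cE rhoE robE reg)//; exact: reg.2.
exact: fine_cvg h.
Qed.

(** The left side is a finite partial sum of the [esum], as distinct [w] give distinct critical
    points. *)
Lemma sum_green_le_PW (R : realType) (E : set (Cplx R))
    (rho : probability (BorelC R) R) (gam : R) (ws : seq R) :
  compact E -> supported_in E rho -> robin E = gam%:E -> is_regular E rho ->
  uniq ws -> (forall w, w \in ws -> critical_points E rho (w +i* 0)) ->
  ((\sum_(w <- ws) fine (green E rho (w +i* 0)))%:E <= PW E rho)%E.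
Proof.
move=> cE rhoE robE reg uws cws.
pose zs : seq (Cplx R) := map (fun w => w +i* 0) ws.
apply: esum_ge; exists [set` zs].
  split; first exact: finite_seq.
  by move=> _ /mapP[w /cws cw ->].
rewrite -fsbig_seq; last by rewrite map_inj_uniq// => a b [].
rewrite -sumEFin big_map lee_sum// => w _.
by rewrite fineK// (green_fin_num _ cE rhoE robE reg).
Qed.

(** * Sums of the Green function over level sets *)

Lemma level_set_roots (R : realType) (E : set (Cplx R))
    (rho : probability (BorelC R) R) (gam pw M c : R) (n : nat) (P : {poly R}) :
  compact E -> E `<=` [set z : Cplx R | complex.Im z = 0] ->
  supported_in E rho -> robin E = gam%:E -> is_regular E rho ->
  PW E rho = pw%:E -> (0 < n)%N -> extremal (real_trace E) n M P -> `|c| < M ->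
  exists rs : seq R, [/\ P - c%:P = \prod_(y <- rs) ('X - y%:P), size rs = n,
    forall y, y \in rs -> (exists2 x, real_trace E x & x <= y) /\
                          (exists2 x, real_trace E x & y <= x) &
    \sum_(y <- rs) fine (green E rho (y +i* 0)) <= pw].
Proof.
move=> cE Er rhoE robE reg pwE n0 exP cM.
have cA := compact_real_trace cE Er.
(* [E] is nonempty because it carries the full mass of [rho]. *)
have A0 : real_trace E !=set0.
  have [E0|/set0P[z Ez]] := eqVneq E set0.
    by have := support_full cE rhoE; rewrite E0 measure0 => /eqP; rewrite eqe eq_sym oner_eq0.
  by exists (complex.Re z); rewrite /real_trace /= -(real_point Er Ez).
have [Pm sP _ _] := exP.
have sc : (size (- c%:P : {poly R}) < size P)%N.
  by rewrite size_polyN sP ltnS (leq_trans (size_polyC_leq1 _)).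
have Dm : P - c%:P \is monic by rewrite monicE lead_coefDl.
have noq q Q : P - c%:P = q * Q -> (1 < size q)%N ->
    ~ forall x, real_trace E x -> 0 < q.[x].
  by move=> Pc q1 qpos; exact: (no_positive_factor cA A0 exP cM Pc q1 qpos).
have [|rs rsE] := real_factors Dm.
  by move=> q Q Pc q1 qpos; apply: (noq q Q Pc q1) => x _; exact: qpos.
have hull := prod_hull rsE noq.
exists rs; split=> //.
  have : size (P - c%:P) = (size rs).+1 by rewrite rsE size_prod_XsubC.
  by rewrite size_polyDl// sP => -[].
have prs : pairwise (fun y z => ~~ `[< sign_linked (real_trace E) y z >]) rs.
  by apply: (@prod_pairwise _ _ _ _ 1) noq; rewrite mul1r.
pose g y := fine (green E rho (y +i* 0)).
have cg : continuous g.
  move=> y; apply: (@continuous_comp _ _ _ (fun t : R => t +i* 0 : Cplx R)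
    (fun z => fine (green E rho z))).
    exact: continuous_horizontal.
  exact: (continuous_fine_green cE rhoE robE reg).
have gA x : real_trace E x -> g x = 0 by move=> /(reg.1) gx; rewrite /g gx.
have [|ws [uws cws gws]] :=
  @sum_le_linked R (real_trace E) [set w | critical_points E rho (w +i* 0)] g rs prs.
  move=> y yrs gy; have [h1 h2] := hull y yrs.
  have [w [Aw gyw yw wmax]] := gap_max cA cg gA h1 h2 gy.
  exists w; split=> //; split; first exact: Aw.
  by apply: dz_eq0 => // z; rewrite green_conj.
rewrite (le_trans gws)// -lee_fin -pwE.
exact: (sum_green_le_PW cE rhoE robE reg uws cws).
Qed.

(** The shift takes the roots off the real axis, where [E] lies, and [x - (y + i d) = (x - i d) - y]
    turns the product into a value of [P - c]. The roots stay within [B] since they lie in the hull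
    of the trace. *)
Lemma shifted_level_set (R : realType) (E : set (Cplx R))
    (rho : probability (BorelC R) R) (gam pw M c B d e : R) (n : nat)
    (P : {poly R}) :
  compact E -> E `<=` [set z : Cplx R | complex.Im z = 0] ->
  supported_in E rho -> robin E = gam%:E -> is_regular E rho ->
  PW E rho = pw%:E -> (0 < n)%N -> extremal (real_trace E) n M P -> `|c| < M ->
  (forall x, real_trace E x -> `|x| <= B) ->
  (forall t : R, `|t| <= B ->
    fine (green E rho (t +i* d)) <= fine (green E rho (t +i* 0)) + e) ->
  exists zs : seq (Cplx R), [/\ size zs = n,
    forall z, z \in zs -> complex.Im z = d,
    \sum_(z <- zs) fine (green E rho z) <= pw + e *+ n &
    forall x : R, \prod_(z <- zs) ((x +i* 0) - z) =
      (map_poly (real_complex R) P).[x +i* (- d)] - c%:C].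
Proof.
move=> cE Er rhoE robE reg pwE n0 exP cM AB ge.
have [rs [rsE srs hull grs]] :=
  level_set_roots cE Er rhoE robE reg pwE n0 exP cM.
exists (map (fun y => y +i* d : Cplx R) rs); split.
- by rewrite size_map.
- by move=> _ /mapP[y _ ->].
- rewrite big_map; apply: (@le_trans _ _
    (\sum_(y <- rs) (fine (green E rho (y +i* 0)) + e))).
    rewrite big_seq [leRHS]big_seq ler_sum// => y /hull[[a Aa ay] [b Ab yb]].
    apply: ge; move: (AB a Aa) (AB b Ab); rewrite !ler_norml.
    by move=> /andP[? ?] /andP[? ?]; apply/andP; split; lra.
  by rewrite big_split /= big_const_seq count_predT srs iter_addr_0 lerD2r.
move=> x; rewrite big_map.
transitivity ((map_poly (real_complex R) (P - c%:P)).[x +i* (- d)]).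
  rewrite rsE rmorph_prod horner_prod; apply: eq_bigr => y _.
  rewrite rmorphB /= map_polyX map_polyC /= !hornerE.
  by apply/eqP; rewrite eq_complex /= !subr0 sub0r !eqxx.
by rewrite rmorphB /= map_polyC /= !hornerE.
Qed.

(** * Averaging over the level values *)

Lemma totik_widom_approx (R : realType) (E : set (Cplx R))
    (rho : probability (BorelC R) R) (gam pw M B d e : R) (n : nat)
    (P : {poly R}) :
  compact E -> E `<=` [set z : Cplx R | complex.Im z = 0] ->
  supported_in E rho -> robin E = gam%:E -> is_regular E rho ->
  PW E rho = pw%:E -> (0 < n)%N -> extremal (real_trace E) n M P -> 0 < M ->
  (forall x, real_trace E x -> `|x| <= B) -> 0 < d ->
  (forall t : R, `|t| <= B ->
    fine (green E rho (t +i* d)) <= fine (green E rho (t +i* 0)) + e) ->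
  gam *+ n + ln (M / 2) <= pw + e *+ n.
Proof.
move=> cE Er rhoE robE reg pwE n0 exP M0 AB d0 ge.
pose Q (x : R) : R[i] := (map_poly (real_complex R) P).[x +i* (- d)].
have level c : `|c| < 1 -> exists zs : seq (Cplx R), [/\ size zs = n,
    forall z, z \in zs -> complex.Im z = d,
    \sum_(z <- zs) fine (green E rho z) <= pw + e *+ n &
    forall x : R, \prod_(z <- zs) ((x +i* 0) - z) = Q x - (M * c)%:C].
  move=> c1; apply: (shifted_level_set cE Er rhoE robE reg pwE n0 exP _ AB ge).
  by rewrite normrM gtr0_norm// gtr_pMr.
(* Each of the [n] factors [x - z] has imaginary part [- d], so [|Q x - M c| >= d ^+ n]; dividing by
   [M] gives the separation. *)
have [|cs [cs0 cs1 hcs]] := @chebyshev_lower_bound R (d ^+ n / M).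
  by rewrite divr_gt0 ?exprn_gt0.
have MC : M%:C != 0 :> R[i] by rewrite (inj_eq (@complexI R)) gt_eqF.
have QM x c : Q x - (M * c)%:C = M%:C * (Q x / M%:C - c%:C).
  by rewrite mulrBr mulrCA divff// mulr1; congr (_ - _); exact: rmorphM.
have Q_far (x c : R) : `|c| < 1 -> d ^+ n / M <= normc (Q x / M%:C - c%:C).
  move=> /level[zs [szs imz _ Qz]].
  rewrite ler_pdivrMr// mulrC -{1}(gtr0_norm M0) -(normc_real M) -normcM -QM -Qz.
  rewrite -szs; elim: zs imz {szs Qz} => [|z s IH] imz.
    by rewrite big_nil expr0 normc1.
  rewrite big_cons exprS normcM ler_pM ?exprn_ge0 ?(ltW d0)//; last first.
    by apply: IH => y ys; apply: imz; rewrite inE ys orbT.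
  have := imz z; rewrite inE eqxx => /(_ isT); case: (z) => a b /= ->.
  rewrite sub0r sqrrN -[leLHS](gtr0_norm d0) -sqrtr_sqr ler_wsqrtr//.
  by rewrite lerDr sqr_ge0.
(* Pool the shifted roots of all the levels [M * c], for [c] in [cs]. *)
have {}level : exists zs : seq (Cplx R), [/\ size zs = (n * size cs)%N,
    forall z, z \in zs -> complex.Im z = d,
    \sum_(z <- zs) fine (green E rho z) <= (pw + e *+ n) *+ size cs &
    forall x : R, \prod_(z <- zs) ((x +i* 0) - z) =
      M%:C ^+ size cs * \prod_(c <- cs) (Q x / M%:C - c%:C)].
  elim: cs cs1 {cs0 hcs} => [|c s IH] cs1.
    by exists [::]; split=> [||//|x]; rewrite ?muln0 ?big_nil ?mulr0n// mulr1.
  have [zs [szs imz sz pz]] := level c (cs1 c (mem_head _ _)).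
  have [|zs' [szs' imz' sz' pz']] := IH.
    by move=> c' c's; apply: cs1; rewrite inE c's orbT.
  exists (zs ++ zs'); split.
  - by rewrite size_cat szs szs' /= mulnS.
  - by move=> z; rewrite mem_cat => /orP[/imz|/imz'].
  - by rewrite big_cat /= mulrS lerD.
  - by move=> x; rewrite big_cat /= pz pz' QM big_cons exprS mulrACA.
have [zs [szs imz sz pz]] := level.
have K0 : 0 < (M / 2) ^+ size cs by rewrite exprn_gt0// divr_gt0.
have zE z : z \in zs -> ~ E z.
  by move=> /imz zd /Er /=; rewrite zd => d00; rewrite d00 ltxx in d0.
have := sum_green_ge cE rhoE robE K0 zE _ => /(_ _)/wrap[x Ex|].
  rewrite [x](real_point Er Ex) pz normcM normcX normc_real gtr0_norm//.
  rewrite exprMn ler_pM2l ?exprn_gt0// hcs// => c c1; exact: Q_far.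
(* Every term is now a multiple of [size cs], which is positive and cancels. *)
rewrite szs mulrnA lnXn ?divr_gt0// -mulrnDl => h.
have := le_trans h sz; rewrite -[leLHS]mulr_natr -[leRHS]mulr_natr.
by rewrite ler_pM2r// ltr0n.
Qed.

(** A tolerance of [e / n] for each root costs [e] in total, and [e] is arbitrary. *)
Lemma totik_widom_ln (R : realType) (E : set (Cplx R))
    (rho : probability (BorelC R) R) (gam pw M : R) (n : nat) (P : {poly R}) :
  compact E -> E `<=` [set z : Cplx R | complex.Im z = 0] ->
  supported_in E rho -> robin E = gam%:E -> is_regular E rho ->
  PW E rho = pw%:E -> (0 < n)%N -> extremal (real_trace E) n M P -> 0 < M ->
  gam *+ n + ln (M / 2) <= pw.
Proof.
move=> cE Er rhoE robE reg pwE n0 exP M0.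
have [B0 [_ AB]] := compact_bounded (compact_real_trace cE Er).
(* [compact_bounded] provides bounds only strictly above [B0]. *)
pose B := B0 + 1.
have {}AB x : real_trace E x -> `|x| <= B by apply: AB; rewrite ltrDl.
apply/ler_addgt0Pr => e e0.
have en : 0 < e / n%:R by rewrite divr_gt0// ltr0n.
have [d d0 gd] :=
  vertical_uniform B (continuous_fine_green cE rhoE robE reg) en.
have := totik_widom_approx cE Er rhoE robE reg pwE n0 exP M0 AB d0 gd.
by rewrite -[e / _ *+ _]mulr_natr divfK// pnatr_eq0 -lt0n.
Qed.

(** * Passage from the complex Chebyshev polynomial to a real one, and conclusion *)

Lemma horner_bounded (R : realType) (E : set (Cplx R)) (T : {poly R[i]}) :
  compact E -> E `<=` [set z : Cplx R | complex.Im z = 0] ->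
  exists K : R, forall z, E z -> normc T.[z] <= K.
Proof.
move=> cE Er.
have [B0 [_ AB]] := compact_bounded (compact_real_trace cE Er).
pose B := B0 + 1.
have {}AB z : E z -> normc z <= B.
  move=> Ez; have := AB B _ (complex.Re z); rewrite ltrDl ltr01 => /(_ isT).
  rewrite /real_trace /= -(real_point Er Ez) => /(_ Ez).
  by rewrite -normc_real -[(complex.Re z)%:C](real_point Er Ez).
elim/poly_ind: T => [|T c [K TK]].
  by exists 0 => z _; rewrite horner0 normc0.
exists (K * B + normc c) => z Ez.
rewrite !hornerE (le_trans (le_normcD _ _))// lerD2r normcM.
by rewrite ler_pM ?normc_ge0 ?TK ?AB.
Qed.

(** Take the real parts of the coefficients: on the real line [P] is the real part of [T], so its
    modulus is no larger, and the leading coefficient is still 1. *)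
Lemma chebyshev_extremal (R : realType) (E : set (Cplx R)) (n : nat)
    (T : {poly R[i]}) (M : R) :
  E `<=` [set z : Cplx R | complex.Im z = 0] ->
  is_chebyshev E n T -> supnorm E (horner T) = M%:E ->
  exists P : {poly R}, extremal (real_trace E) n M P.
Proof.
move=> Er [Tm sT minT] TM.
have Tn : T`_n = 1 by rewrite -(eqP Tm) /lead_coef sT.
pose P := \poly_(i < n.+1) complex.Re T`_i.
have sP : size P = n.+1 by rewrite size_poly_eq// Tn /= oner_neq0.
have PT (x : R) : P.[x] = complex.Re T.[x +i* 0].
  rewrite horner_poly horner_coef sT (raddf_sum (@complex.Re R : Rcomplex R -> R)).
  apply: eq_bigr => i _; have -> : (x +i* 0) ^+ i = (x ^+ i)%:C by rewrite rmorphXn.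
  by case: (T`_i) => a b /=; rewrite mulr0 subr0.
exists P; split=> //.
- by rewrite monicE lead_coef_poly// Tn ?oner_neq0.
- move=> x Ax; rewrite PT -lee_fin -TM.
  apply: (@le_trans _ _ (normc T.[x +i* 0])%:E).
    by rewrite lee_fin -lecR -normcE_R normc_ge_Re.
  by apply: ereal_sup_ubound; exists (x +i* 0).
- move=> Q L Qm sQ QL; rewrite -lee_fin -TM.
  apply: (@le_trans _ _ (supnorm E (horner (map_poly (real_complex R) Q)))).
    by apply: minT; rewrite ?map_monic// size_map_poly.
  apply: ge_ereal_sup => _ [z Ez <-]; rewrite lee_fin (real_point Er Ez).
  rewrite -[_ +i* 0]/(_%:C) horner_map normc_real QL//.
  by rewrite /real_trace /= -(real_point Er Ez).
Qed.

Local Open Scope ereal_scope.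

Theorem theorem1p4 (R : realType) (E : set (Cplx R))
    (rho : probability (BorelC R) R) (n : nat) (T : {poly R[i]}) :
  compact E ->
  E `<=` [set z : Cplx R | complex.Im z = 0%R] ->
  is_equilibrium_measure E rho ->
  is_regular E rho ->
  PW E rho < +oo ->
  (1 <= n)%N ->
  is_chebyshev E n T ->
  supnorm E (horner T) <= 2%:E * expeR (PW E rho) * capacity E ^+ n.
Proof.
move=> cE Er [cap0 rhoE _] reg PWy n1 chT.
have PW0 : 0 <= PW E rho.
  by apply: esum_ge; exists set0; rewrite ?fsbig_set0//; exact: fsets_set0.
have [pw pwE] : exists pw : R, PW E rho = pw%:E.
  by exists (fine (PW E rho)); rewrite fineK// ge0_fin_numE.
rewrite pwE /capacity /=.
case robE : (robin E) => [gam| |]; last first.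
(* Here [robin E = -oo]: the capacity is [+oo], and so is the right-hand side because [n] is
   positive. *)
- rewrite /= (_ : +oo ^+ n = +oo); last first.
    by case: (n) n1 => // m _; rewrite expeS gt0_mulye// expe_gt0.
  by rewrite gt0_muley ?leey// -EFinM lte_fin mulr_gt0// expR_gt0.
(* Here [robin E = +oo]: the capacity would be 0. *)
- by move: cap0; rewrite /capacity robE /= ltxx.
rewrite -EFinN /= -EFin_expe -!EFinM.
case TM : (supnorm E (horner T)) => [M| |]; last by rewrite leNye.
- have [M0|M0] := leP M 0%R.
    by rewrite lee_fin (le_trans M0)// !mulr_ge0 ?exprn_ge0 ?expR_ge0.
  have [P exP] := chebyshev_extremal Er chT TM.
  have := totik_widom_ln cE Er rhoE robE reg pwE n1 exP M0.
  (* Exponentiating yields [M / 2 <= expR (pw - gam *+ n)]. *)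
  rewrite lee_fin -lerBrDl -ler_expR lnK ?posrE ?divr_gt0// ler_pdivrMr//.
  by rewrite expRD -mulNrn -[(- gam *+ n)%R]mulr_natl expRM_natl => /le_trans -> //; rewrite mulrC mulrA.
have [K TK] := horner_bounded T cE Er.
have : supnorm E (horner T) <= K%:E.
  by apply: ge_ereal_sup => _ [z Ez <-]; rewrite lee_fin TK.
by rewrite TM.
Qed.
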